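(* Every instance of 3DSMI of dimension $n\leqslant 2$ has a stable matching.
   Context: An instance of 3DSMI of dimension $n$ is a directed graph $G$ without multiple edges whose vertex set $V$ is partitioned into three sets $M$, $F$, $D$ with $|M|=|F|=|D|=n$, such that every edge goes from $M$ to $F$, from $F$ to $D$, or from $D$ to $M$. Each edge $(v,v')$ carries a positive integer rank $r(v,v')$ such that, for every vertex $v$ of out-degree $k$, the ranks of the edges leaving $v$ are exactly $1,\dots,k$. A family is a directed $3$-cycle of $G$. A matching $\mathcal M$ is a set of pairwise vertex-disjoint families (possibly empty). For a vertex $v$, $R_{\mathcal M}(v)$ is the rank of the edge leaving $v$ within its family in $\mathcal M$, and $R_{\mathcal M}(v)=+\infty$ if $v$ belongs to no family of $\mathcal M$. A directed $3$-cycle $(v,v',v'')$ of $G$ is blocking for $\mathcal M$ if $r(v,v')<R_{\mathcal M}(v)$, $r(v',v'')<R_{\mathcal M}(v')$ and $r(v'',v)<R_{\mathcal M}(v'')$. A matching is stable if no blocking triple exists for it. *)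

(* Defs.v *)
From mathcomp Require Import all_boot.

Set Implicit Arguments.
Unset Strict Implicit.
Unset Printing Implicit Defensive.

Record instance (n : nat) := Instance {
  vertex : finType;
  males : {set vertex};
  females : {set vertex};
  dogs : {set vertex};
  edge : rel vertex;
  (* only the values on edges are meaningful *)
  rank : vertex -> vertex -> nat;
  cover_sides : males :|: females :|: dogs = [set: vertex];
  disjoint_MF : [disjoint males & females];
  disjoint_FD : [disjoint females & dogs];
  disjoint_DM : [disjoint dogs & males];
  card_males : #|males| = n;
  card_females : #|females| = n;
  card_dogs : #|dogs| = n;
  edge_sides : forall v w : vertex, edge v w ->
    [|| (v \in males) && (w \in females),
        (v \in females) && (w \in dogs)
      | (v \in dogs) && (w \in males)];
  (* with multiplicity: each of 1, ..., k is the rank of exactly one edge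
     leaving v, where k is the out-degree of v *)
  rank_edges : forall v : vertex,
    perm_eq [seq rank v w | w in edge v] (iota 1 #|edge v|)
}.

Section Matchings.

Variables (n : nat) (G : instance n).

Implicit Types (c : 3.-tuple (vertex G)) (MM : {set 3.-tuple (vertex G)}).

(* A directed 3-cycle is given by its vertices in cyclic order, starting from
   any one of them, so its three rotations represent the same family. *)
Definition family3 c : bool := ucycleb (@edge n G) c.

(* Disjointness of distinct triples also excludes two rotations of the same
   family, so every matching is represented without repetition. *)
Definition matching MM : Prop :=
  (forall c, c \in MM -> family3 c) /\
  (forall c1 c2, c1 \in MM -> c2 \in MM -> c1 != c2 -> [disjoint c1 & c2]).

(* [None] stands for +oo.  When [MM] is a matching, at most one triple of [MM]
   contains [v], so that the choice made by [pick] is irrelevant. *)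
Definition matching_rank MM (v : vertex G) : option nat :=
  if [pick c in MM | v \in c] is Some c then Some (rank v (next c v))
  else None.

Definition lt_rank (k : nat) (R : option nat) : bool :=
  if R is Some m then k < m else true.

Definition blocking MM (v v' v'' : vertex G) : Prop :=
  [/\ family3 [tuple v; v'; v''],
      lt_rank (rank v v') (matching_rank MM v),
      lt_rank (rank v' v'') (matching_rank MM v')
    & lt_rank (rank v'' v) (matching_rank MM v'')].

Definition stable MM : Prop :=
  forall v v' v'' : vertex G, ~ blocking MM v v' v''.

End Matchings.

(* Main.v *)
Require Import Defs.
From mathcomp Require Import all_boot.

(** If there are two disjoint families, they form a stable matching: any other
    triple has two vertices, hence an edge, in common with one of them. Suppose
    now that any two families meet, and that a family [T] alone is not stable.
    A family [S] blocking [T] meets [T] in exactly one vertex, which prefers [S]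
    to [T]; so if [S] alone is not stable either, a family [S2] blocking it
    meets [S] in another vertex. The vertices lying in two of the families [T],
    [S], [S2] form a family [P], each edge of which comes from one of the three.
    A family blocking [P] would meet [P] in one vertex only, hence be disjoint
    from the one of [T], [S], [S2] that avoids this vertex; so [P] alone is
    stable. *)

Set Implicit Arguments.
Unset Strict Implicit.
Unset Printing Implicit Defensive.

(** * Sides of the vertices, and families *)

Section Instance.

Variables (n : nat) (G : instance n).

Implicit Types (x y z v w : vertex G) (t u : 3.-tuple (vertex G)).
Implicit Types MM : {set 3.-tuple (vertex G)}.

(** Males, females and dogs are numbered in cyclic order, so that an edge adds 1 modulo 3. *)
Definition side v : nat :=
  if v \in males G then 0 else if v \in females G then 1 else 2.

Lemma edge_side v w : edge v w -> side w = (side v).+1 %% 3.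
Proof.
rewrite /side => /edge_sides.
case/or3P=> /andP [hv hw].
- by rewrite hv hw (disjointFl (disjoint_MF G) hw).
- by rewrite hv (disjointFl (disjoint_MF G) hv) (disjointFl (disjoint_FD G) hw)
     (disjointFr (disjoint_DM G) hw).
- by rewrite hw (disjointFl (disjoint_FD G) hv) (disjointFr (disjoint_DM G) hv).
Qed.

Lemma side_lt3 v : side v < 3.
Proof. by rewrite /side; do 2?case: ifP. Qed.

(** The bound on the dimension acts only through this lemma: three distinct vertices of one side
    would give it at least 3 elements. *)
Lemma side_pigeonhole x y z : n <= 2 -> side x = side y -> side x = side z ->
  [|| x == y, x == z | y == z].
Proof.
move=> hn hxy hxz; apply: contraLR hn => hne.
have hu : uniq [:: x; y; z].
  by rewrite /= !inE !negb_or -andbA andbT; move: hne; rewrite !negb_or.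
have leq_side (A : {set vertex G}) :
    #|A| = n -> [/\ x \in A, y \in A & z \in A] -> 2 < n.
  move=> hA [hx hy hz]; rewrite -hA cardE.
  apply: (uniq_leq_size hu) => a; rewrite mem_enum !inE.
  by case/or3P=> /eqP ->.
have inD v : (v \in males G) = false -> (v \in females G) = false ->
    v \in dogs G.
  by move=> vM vF; have := in_setT v; rewrite -(cover_sides G) !inE vM vF.
rewrite -ltnNge; move: hxy hxz; rewrite /side.
case: (boolP (x \in males G)) => [xM|/negbTE xM];
case: (boolP (y \in males G)) => [yM|/negbTE yM];
case: (boolP (z \in males G)) => [zM|/negbTE zM];
case: (boolP (x \in females G)) => [xF|/negbTE xF];
case: (boolP (y \in females G)) => [yF|/negbTE yF];
case: (boolP (z \in females G)) => [zF|/negbTE zF] // _ _;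
by [ apply: leq_side (card_males G) _ | apply: leq_side (card_females G) _
   | apply: leq_side (card_dogs G) _; split; apply: inD ].
Qed.

(** The distinctness required by [ucycleb] is automatic, as the edges put the three vertices on
    three different sides. *)
Lemma family3E x y z :
  family3 [tuple x; y; z] = [&& edge x y, edge y z & edge z x].
Proof.
rewrite /family3 /ucycleb /= !inE !andbT.
case: (boolP [&& edge x y, _ & _]) => //= /and3P[exy eyz ezx].
have ne v w : side v != side w -> v != w by apply: contraNneq => ->.
have := side_lt3 x; have hy := edge_side exy; have hz := edge_side eyz.
rewrite negb_or => hx.
rewrite !ne // ?hz hy; by case: (side x) hx => [|[|[|]]].
Qed.

Lemma family3_rot x y z :
  family3 [tuple x; y; z] -> family3 [tuple y; z; x].
Proof. by rewrite !family3E => /and3P[-> -> ->]. Qed.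

Lemma tuple3E t : exists x y z, t = [tuple x; y; z].
Proof.
case: t => [[|x [|y [|z [|]]]]] // i; exists x, y, z; exact: val_inj.
Qed.

Lemma side_inj_family t :
  family3 t -> {in t &, forall x y, side x = side y -> x = y}.
Proof.
have [a [b [c ->]]] := tuple3E t.
rewrite family3E => /and3P[/edge_side hb /edge_side hc _].
move=> x y; rewrite !inE; have ha := side_lt3 a.
by case/or3P=> /eqP ->; case/or3P=> /eqP ->; rewrite ?hc ?hb //;
  case: (side a) ha => [|[|[|]]].
Qed.

Lemma mem_family_side t v : family3 t -> exists2 w, w \in t & side w = side v.
Proof.
have [a [b [c ->]]] := tuple3E t.
rewrite family3E => /and3P[/edge_side hb /edge_side hc _].
have ha := side_lt3 a; have hv := side_lt3 v.
have : [|| side a == side v, side b == side v | side c == side v].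
  rewrite hc hb; case: (side a) ha => [|[|[|]]] // _;
  by case: (side v) hv => [|[|[|]]].
by case/or3P=> /eqP h; [exists a | exists b | exists c];
  rewrite // !inE eqxx ?orbT.
Qed.

Lemma edge_next_family t x : family3 t -> x \in t -> edge x (next t x).
Proof. by case/andP=> /next_cycle h _; apply: h. Qed.

Lemma next_family t x y : family3 t -> x \in t -> y \in t ->
  side y = (side x).+1 %% 3 -> y = next t x.
Proof.
move=> ht xt yt hs; apply: (side_inj_family ht) => //; first by rewrite mem_next.
by rewrite hs (edge_side (edge_next_family ht xt)).
Qed.

Lemma edge_family t x y : family3 t -> x \in t -> y \in t ->
  side y = (side x).+1 %% 3 -> edge x y.
Proof. by move=> ht xt yt /(next_family ht xt yt) ->; apply: edge_next_family. Qed.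

(** On the side of [v], the two families have distinct vertices, which exhaust that side. *)
Lemma mem_two_families t u v : n <= 2 -> family3 t -> family3 u ->
  [disjoint t & u] -> (v \in t) || (v \in u).
Proof.
move=> hn ht hu tu.
have [a at_ sa] := mem_family_side v ht; have [b bu sb] := mem_family_side v hu.
case/or3P: (@side_pigeonhole v a b hn (esym sa) (esym sb)) => /eqP h.
- by rewrite h at_.
- by rewrite h bu orbT.
- by rewrite -h (disjointFr tu at_) in bu.
Qed.

(** * Ranks in a matching and blocking triples *)

Lemma matching_rank_mem MM t x : matching MM -> t \in MM -> x \in t ->
  matching_rank MM x = Some (rank x (next t x)).
Proof.
move=> [_ hd] tM xt; rewrite /matching_rank; case: pickP => [u|/(_ t)].
  case/andP=> uM xu; case: (eqVneq t u) => [-> //|/hd h].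
  by rewrite (disjointFr (h tM uM) xt) in xu.
by rewrite tM xt.
Qed.

Lemma blocking_rot MM x y z : blocking MM x y z -> blocking MM y z x.
Proof. by case=> /family3_rot hf hx hy hz; split. Qed.

(** Otherwise [y], being on the side after that of [x], would be the successor of [x] in [t], and
    [rank x y] would be smaller than itself. *)
Lemma blocking_edge MM t x y z : matching MM -> t \in MM ->
  blocking MM x y z -> x \in t -> y \notin t.
Proof.
move=> hM tM [hf hx _ _] xt; apply/negP=> yt; move: hx hf.
rewrite (matching_rank_mem hM tM xt) family3E /= => hlt /and3P[/edge_side hs _ _].
by rewrite -(next_family (hM.1 _ tM) xt yt hs) ltnn in hlt.
Qed.

Lemma stable_or_blocked MM : stable MM \/ exists x y z, blocking MM x y z.
Proof.
pose b x y z := [&& family3 [tuple x; y; z],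
  lt_rank (rank x y) (matching_rank MM x),
  lt_rank (rank y z) (matching_rank MM y)
  & lt_rank (rank z x) (matching_rank MM z)].
case: (boolP [exists x, exists y, exists z, b x y z]) => [|/negP h].
  case/existsP=> x /existsP[y /existsP[z /and4P[]]].
  by right; exists x, y, z; split.
left=> x y z [h1 h2 h3 h4]; apply: h.
by apply/existsP; exists x; apply/existsP; exists y; apply/existsP; exists z;
  apply/and4P.
Qed.

Lemma matching0 : matching (set0 : {set 3.-tuple (vertex G)}).
Proof. by split=> [c|c1 c2]; rewrite inE. Qed.

Lemma matching1 t : family3 t -> matching [set t].
Proof.
by move=> ht; split=> [c|c1 c2]; rewrite !inE => /eqP -> // /eqP ->; rewrite eqxx.
Qed.

Lemma matching2 t u :
  family3 t -> family3 u -> [disjoint t & u] -> matching [set t; u].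
Proof.
move=> ht hu tu; split=> [c|c1 c2]; rewrite !inE; first by case/orP=> /eqP ->.
by case/orP=> /eqP -> /orP[] /eqP ->; rewrite ?eqxx // disjoint_sym.
Qed.

Lemma stable2 t u : n <= 2 -> family3 t -> family3 u -> [disjoint t & u] ->
  stable [set t; u].
Proof.
move=> hn ht hu tu x y z hb; have hM := matching2 ht hu tu.
have hb' := blocking_rot hb; have hb'' := blocking_rot hb'.
have nt := @blocking_edge _ t _ _ _ hM (set21 _ _).
have nu := @blocking_edge _ u _ _ _ hM (set22 _ _).
have cov v := mem_two_families v hn ht hu tu.
have := cov x; have := cov y; have := cov z.
have := nt _ _ _ hb; have := nt _ _ _ hb'; have := nt _ _ _ hb''.
have := nu _ _ _ hb; have := nu _ _ _ hb'; have := nu _ _ _ hb''.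
(* Two of [x], [y], [z] lie in the same family; up to rotation they are consecutive, which [nt] and
   [nu] exclude. *)
case: (x \in t); case: (y \in t); case: (z \in t);
case: (x \in u); case: (y \in u); case: (z \in u) => //=;
  do ?[move=> /(_ isT) // | move=> _].
Qed.

(** * Instances in which any two families meet *)

Hypothesis meet : forall t u, family3 t -> family3 u -> ~~ [disjoint t & u].

Lemma family3_mem t x y z : family3 t -> family3 [tuple x; y; z] ->
  [|| x \in t, y \in t | z \in t].
Proof.
move=> ht hf; move: (meet hf ht); apply: contraR.
by rewrite disjoint_has /= orbF.
Qed.

(** By [meet], a blocking family shares a vertex with [t]. It is rotated to start there, and
    [blocking_edge] keeps its other two vertices out of [t]. *)
Lemma stable1_or_blocked t : family3 t -> stable [set t] \/
  exists x y z, [/\ family3 [tuple x; y; z], x \in t, y \notin t, z \notin t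
                  & rank x y < rank x (next t x)].
Proof.
move=> ht; have hM := matching1 ht.
case: (stable_or_blocked [set t]) => [|[x [y [z hb]]]]; [by left | right].
have blocked a b c : blocking [set t] a b c -> a \in t ->
    exists x y z, [/\ family3 [tuple x; y; z], x \in t, y \notin t, z \notin t
                    & rank x y < rank x (next t x)].
  move=> hb' hat; exists a, b, c.
  have bt := blocking_edge hM (set11 t) hb' hat.
  have ct : c \notin t.
    apply/negP=> /(blocking_edge hM (set11 t) (blocking_rot (blocking_rot hb'))).
    by rewrite hat.
  case: hb' => hf; rewrite (matching_rank_mem hM (set11 t) hat) /= => hr _ _.
  by split.
have [hf _ _ _] := hb; case/or3P: (family3_mem ht hf); apply: blocked.
- exact: hb.
- exact: blocking_rot hb.
- exact: blocking_rot (blocking_rot hb).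
Qed.

Lemma stable1_majority p : family3 p ->
  (forall x, x \in p -> exists t : 3.-tuple (vertex G),
     [/\ family3 t, x \notin t & {in p, forall v, v != x -> v \in t}]) ->
  stable [set p].
Proof.
move=> hp maj; case: (stable1_or_blocked hp) => // -[x [y [z [hf xp yp zp _]]]].
have [t [ht xt pt]] := maj _ xp.
(* On the sides other than that of [x], the vertices of [t] are those of [p]. So the blocking
   family, which meets [p] only in [x], avoids [t], against [meet]. *)
have notin_t v : v \notin p -> side v != side x -> v \notin t.
  move=> vp; apply: contraNN => vt; have [w wp sw] := mem_family_side v hp.
  case: (eqVneq w x) sw => [-> <-|wx sw]; first by [].
  by move: vp; rewrite -(side_inj_family ht (pt w wp wx) vt sw) wp.
have := family3_mem ht hf; move: hf; rewrite family3E.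
case/and3P=> /edge_side sy /edge_side sz _.
have hx := side_lt3 x.
rewrite (negbTE xt) (negbTE (notin_t y yp _)) ?(negbTE (notin_t z zp _)) //.
  by rewrite sz sy; case: (side x) hx => [|[|[|]]].
by rewrite sy; case: (side x) hx => [|[|[|]]].
Qed.

(** The vertices [v] and [w] exhaust their side, on which [t] has a vertex. *)
Lemma mem_family_other t v w : n <= 2 -> family3 t -> side v = side w ->
  v != w -> w \notin t -> v \in t.
Proof.
move=> hn ht hs hne wt; have [a at_ sa] := mem_family_side v ht.
case/or3P: (@side_pigeonhole v w a hn hs (esym sa)) => /eqP h.
- by rewrite h eqxx in hne.
- by rewrite h.
- by rewrite h at_ in wt.
Qed.

Lemma stable1_exists t : n <= 2 -> family3 t ->
  exists2 p : 3.-tuple (vertex G), family3 p & stable [set p].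
Proof.
move=> hn ht; have [|[x [y [z [hs xt yt zt rt]]]]] := stable1_or_blocked ht.
  by exists t.
set s := [tuple x; y; z] in hs.
have [|[a [b [c [hu as_ bs cs ru]]]]] := stable1_or_blocked hs.
  by exists s.
set u := [tuple a; b; c] in hu.
move: (hs) (hu); rewrite !family3E => /and3P[exy eyz ezx] /and3P[eab ebc eca].
have [sy sz sx] := And3 (edge_side exy) (edge_side eyz) (edge_side ezx).
have [sb sc sa] := And3 (edge_side eab) (edge_side ebc) (edge_side eca).
have [xs ys zs] : [/\ x \in s, y \in s & z \in s] by rewrite !inE !eqxx !orbT.
have [au bu cu] : [/\ a \in u, b \in u & c \in u] by rewrite !inE !eqxx !orbT.
have ne v w : v \in s -> w \notin s -> v != w.
  by move=> vs; apply: contraNneq => <-.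
have net v w : v \in t -> w \notin t -> v != w.
  by move=> vs; apply: contraNneq => <-.
(* The vertex [x] is in [s], whereas [b] and [c] are not. *)
have xu : a != x -> x \notin u.
  move=> ax; rewrite !inE (negbTE (ne x b _ _)) ?(negbTE (ne x c _ _)) //.
  by rewrite eq_sym (negbTE ax).
move: (as_); rewrite !inE => /or3P[] /eqP ea.
(* Case [a = x]: then [x] has the same successor [b] in [t] and in [u], although it strictly prefers
   its edge in [u] to that in [s], and the latter to that in [t]. *)
- have bt : b \in t.
    by apply: (@mem_family_other t b y); rewrite // ?sb ?ea ?sy // eq_sym ne.
  move: ru; rewrite ea -(next_family hs xs ys sy).
  rewrite (next_family ht xt bt) -?ea // ea => ru.
  by have := ltn_trans ru rt; rewrite ltnn.
- have bt : b \in t.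
    by apply: (@mem_family_other t b z); rewrite // ?sb ?ea ?sz // eq_sym ne.
  (* Case [a = y]: the edges of this majority family come from [s], [u], [t] in turn, and the
     families avoiding [x], [y], [b] are [u], [t], [s]. *)
  have hp : family3 [tuple x; y; b].
    rewrite family3E exy -ea eab; apply: (edge_family ht) => //.
    by rewrite sx sz sb ea.
  exists [tuple x; y; b] => //; apply: stable1_majority => // v.
  rewrite !inE => /or3P[] /eqP ->.
  + exists u; split=> //; first by rewrite xu // ea eq_sym net.
    by move=> w; rewrite !inE => /or3P[] /eqP -> //; rewrite ?eqxx ?ea ?eqxx ?orbT.
  + exists t; split=> // w.
    by rewrite !inE => /or3P[] /eqP -> //; rewrite eqxx.
  + exists s; split=> // w.
    by rewrite !inE => /or3P[] /eqP -> //; rewrite eqxx ?orbT.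
- have ct : c \in t.
    by apply: (@mem_family_other t c y);
      rewrite // ?sc ?sb ?ea -?sx ?sy // eq_sym ne.
  (* Case [a = z]: the edges come from [t], [u], [s] in turn, and the families avoiding [x], [c],
     [z] are [u], [s], [t]. *)
  have hp : family3 [tuple x; c; z].
    rewrite family3E ezx -ea eca !andbT; apply: (edge_family ht) => //.
    by rewrite sc sb ea -sx.
  exists [tuple x; c; z] => //; apply: stable1_majority => // v.
  rewrite !inE => /or3P[] /eqP ->.
  + exists u; split=> //; first by rewrite xu // ea eq_sym net.
    by move=> w; rewrite !inE => /or3P[] /eqP -> //; rewrite ?eqxx ?ea ?eqxx ?orbT.
  + exists s; split=> // w.
    by rewrite !inE => /or3P[] /eqP -> //; rewrite eqxx ?orbT.
  + exists t; split=> // w.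
    by rewrite !inE => /or3P[] /eqP -> //; rewrite eqxx.
Qed.

End Instance.

Theorem theorem2 (n : nat) (hn : n <= 2) (G : instance n) :
  exists MM : {set 3.-tuple (vertex G)}, matching MM /\ stable MM.
Proof.
case: (boolP [exists t : 3.-tuple (vertex G), exists u : 3.-tuple (vertex G),
  [&& family3 t, family3 u & [disjoint t & u]]]) => [|/existsPn meet].
  case/existsP=> t /existsP[u /and3P[ht hu tu]].
  by exists [set t; u]; split; [apply: matching2 | apply: stable2].
case: (boolP [exists t : 3.-tuple (vertex G), family3 t]) => [|/existsPn nof].
  case/existsP=> t ht; have [|p hp sp] := stable1_exists _ hn ht.
    move=> v w hv hw; apply: contraNN (meet v) => vw.
    by apply/existsP; exists w; rewrite hv hw.
  by exists [set p]; split=> //; apply: matching1.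
(* Without families there is no blocking triple. *)
exists set0; split; first exact: matching0.
by move=> x y z [hf _ _ _]; have := nof [tuple x; y; z]; rewrite hf.
Qed.
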